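(* Let $r\ge1$, let $m_1,\ldots,m_r$ be positive integers, $m=m_1+\cdots+m_r$, $\omega=m-m_1$, let $a$ be real, let $f_1,\ldots,f_r$ be real numbers none of which is a nonpositive integer, and let $$F_m(t)=\frac{(f_1+t)_{m_1}(f_2+t)_{m_2}\cdots(f_r+t)_{m_r}}{(f_1)_{m_1}(f_2)_{m_2}\cdots(f_r)_{m_r}} .$$ Then the expansion of $\hat{w}(a;F_m\,|\,x)$ in the Bernstein basis $x^k(1-x)^{m-k}$, $k=0,\ldots,m$, is given by $$\hat{w}(a;F_m\,|\,x)=(1-x)^m\,w\Big(a;F_m\,\Big|\,\frac{x}{x-1}\Big)=\sum_{k=0}^{m}(-1)^k\frac{(a)_k(-m)_k}{(f_1)_k\,k!}Q_\omega(k)\,x^k(1-x)^{m-k},$$ where $$Q_\omega=T_\omega(f_1+m_1;f_1)H,\qquad H(t)=\frac{(f_2+t)_{m_2}\cdots(f_r+t)_{m_r}}{(f_2)_{m_2}\cdots(f_r)_{m_r}},$$ and $T_\omega$ is the first Miller–Paris operator. In other words, up to the factors $(-1)^k$, the coefficients of $w(a;F_m\,|\,y)$ in the monomial basis $y^k$ are equal to the coefficients of $\hat{w}(a;F_m\,|\,x)$ in the Bernstein basis $x^k(1-x)^{m-k}$, and vice versa (with the roles of $w$ and $\hat{w}$ exchanged).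
   Context: $(b)_n=b(b+1)\cdots(b+n-1)$, $(b)_0=1$, is the Pochhammer symbol. The polynomial $\hat{w}(a;F_m\,|\,x)$ of degree at most $m$ is defined by $$\sum_{n=0}^{\infty}F_m(n)\frac{(a)_n}{n!}x^n=\frac{\hat{w}(a;F_m\,|\,x)}{(1-x)^{m+a}} .$$ The polynomial $w(a;F_m\,|\,y)$ of degree at most $m$ in $y$ is defined by $$(1-x)^a\sum_{n=0}^{\infty}F_m(n)\frac{(a)_n}{n!}x^n=w\Big(a;F_m\,\Big|\,\frac{x}{x-1}\Big),\qquad\text{i.e.}\qquad w(a;F_m\,|\,y)=\sum_{k=0}^{m}\frac{(a)_k}{k!}\Big(\sum_{j=0}^{k}\frac{(-k)_j}{j!}F_m(j)\Big)y^k .$$ First Miller–Paris operator: for an integer $\omega\ge0$ and parameters with $(\rho-\epsilon-\omega)_\omega\ne0$, $T_\omega(\epsilon;\rho)$ acts on polynomials $H$ of degree at most $\omega$ by $$[T_\omega(\epsilon;\rho)H](t)=\frac{1}{(\rho-\epsilon-\omega)_\omega}\sum_{k=0}^{\omega}\frac{(-1)^k(\epsilon)_k(-t)_k(\rho-\epsilon-\omega+t)_{\omega-k}}{k!}\sum_{j=0}^{k}\frac{(-k)_j}{j!}H(j).$$ *)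

(* Defs.v *)
From HB Require Import structures.
From mathcomp Require Import all_boot all_order all_algebra.
From mathcomp Require Import all_classical all_reals all_analysis.

Set Implicit Arguments.
Unset Strict Implicit.
Unset Printing Implicit Defensive.

Import Order.TTheory GRing.Theory Num.Theory.
Import numFieldNormedType.Exports.

Local Open Scope classical_set_scope.
Local Open Scope ring_scope.

(* (b)_n = b (b + 1) ... (b + n - 1), in any ring: it is used both for scalars
   and for polynomials in t, e.g. (-t)_k is [poch (- 'X) k]. *)
Definition poch (S : nzRingType) (b : S) (n : nat) : S :=
  \prod_(i < n) (b + i%:R).

Section MillerParis.
Variable R : realType.
Implicit Types (a x : R) (F H p : {poly R}).

Definition hyp_series a F x : R^nat :=
  [series F.[n%:R] * (poch a n / n`!%:R) * x ^+ n]_n.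

(* The power series has radius of convergence at least 1 and 1 - x > 0 on the
   disc, so the real power is the principal one. *)
Definition is_what a m F p : Prop :=
  (size p <= m.+1)%N /\
  forall x, `|x| < 1 ->
    hyp_series a F x @ \oo --> p.[x] / (1 - x) `^ (m%:R + a).

Definition is_w a m F p : Prop :=
  (size p <= m.+1)%N /\
  forall x, `|x| < 1 ->
    (fun N : nat => (1 - x) `^ a * hyp_series a F x N) @ \oo
      --> p.[x / (x - 1)].

Definition alt_sum H (k : nat) : R :=
  \sum_(j < k.+1) poch (- k%:R) j / j`!%:R * H.[j%:R].

Definition w_poly a (m : nat) F : {poly R} :=
  \poly_(k < m.+1) (poch a k / k`!%:R * alt_sum F k).

(* [T_omega(eps; rho) H](t) as a polynomial in t = 'X; meaningful when
   poch (rho - eps - omega%:R) omega != 0 and H has degree at most omega. *)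
Definition miller_paris1 (omega : nat) (eps rho : R) H : {poly R} :=
  (poch (rho - eps - omega%:R) omega)^-1 *:
  \sum_(k < omega.+1)
    ((-1) ^+ k * poch eps k / k`!%:R * alt_sum H k) *:
    (poch (- 'X) k * poch ((rho - eps - omega%:R)%:P + 'X) (omega - k)).

Definition poch_quotient (r : nat) (P : pred 'I_r) (f : 'I_r -> R)
    (mm : 'I_r -> nat) : {poly R} :=
  (\prod_(i < r | P i) poch (f i) (mm i))^-1 *:
  \prod_(i < r | P i) poch ((f i)%:P + 'X) (mm i).

(* Bernstein basis without the binomial normalisation. *)
Definition bern (m k : nat) : {poly R} := 'X^k * (1 - 'X) ^+ (m - k).

End MillerParis.

Arguments bern {R} m k.

(* Main.v *)
Require Import Defs.
From HB Require Import structures.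
From mathcomp Require Import all_boot all_order all_algebra.
From mathcomp Require Import all_classical all_reals all_analysis.
From mathcomp Require Import ring lra.
Import Order.TTheory GRing.Theory Num.Theory.
Import numFieldNormedType.Exports.
Local Open Scope ring_scope.

(** Write y = x / (x - 1) and let c_k be the k-th alternating sum of F, that is
    [alt_sum F k], the sum over j of (-k)_j / j! F(j).

    Newton's expansion F(n) = sum_k c_k (-n)_k / k! ([newton_expansion]),
    inserted into the series, and the binomial series
    sum_n (b)_n / n! x^n = (1 - x)^(-b) ([binom_seriesE]) give, for |x| < 1,
    sum_n F(n) (a)_n / n! x^n = (1 - x)^(-a) w(y) ([hyp_series_cvg]).
    Hence w(y), and (1 - x)^m w(y), are the polynomials called w and w-hat; each
    is unique because the sum of the series fixes its values at infinitely many
    points.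

    The map p |-> (1 - x)^m p(y) sends y^k to (-1)^k x^k (1 - x)^(m - k), so it
    turns monomial coefficients into Bernstein coefficients up to sign. Since
    x |-> x / (x - 1) is an involution, so is this map ([bern_flipK]), which
    gives both exchanges of coefficients between w and w-hat.

    It remains to compute c_k. With c = f_1, p = m_1 and e = c + p one has
    F(j) = (e)_j / (c)_j H(j); expanding H by Newton's formula reduces c_k to
    the sums of (-k)_j / j! (e)_j / (c)_j (-j)_l over j, which the
    Chu-Vandermonde identity evaluates ([alt_sum_poch_ratio]). The outcome is
    (-m)_k / (c)_k times the value at k of the first Miller-Paris operator
    applied to H ([alt_sum_miller_paris]). *)

(** * Pochhammer symbols and the Chu-Vandermonde identity *)

Lemma poch0 (S : nzRingType) (b : S) : poch b 0 = 1.
Proof. by rewrite /poch big_ord0. Qed.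

Lemma pochSr (S : nzRingType) (b : S) n :
  poch b n.+1 = poch b n * (b + n%:R).
Proof. by rewrite /poch big_ord_recr. Qed.

Lemma pochD (S : nzRingType) (b : S) i j :
  poch b (i + j) = poch b i * poch (b + i%:R) j.
Proof.
elim: j => [|j IH]; first by rewrite addn0 poch0 mulr1.
by rewrite addnS !pochSr IH -mulrA natrD addrA.
Qed.

Lemma pochSl (S : nzRingType) (b : S) n :
  poch b n.+1 = b * poch (b + 1) n.
Proof. by rewrite -add1n pochD /poch big_ord1 addr0. Qed.

Lemma poch_neq0 (S : idomainType) (b : S) n :
  (forall i : nat, (i < n)%N -> b != - i%:R) -> poch b n != 0.
Proof.
move=> b_neq; apply/prodf_neq0 => i _.
by rewrite addr_eq0 b_neq.
Qed.

Lemma horner_poch (S : comNzRingType) (p : {poly S}) n x :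
  (poch p n).[x] = poch p.[x] n.
Proof.
rewrite /poch horner_prod; apply: eq_bigr => i _.
by rewrite hornerD -polyC_natr hornerC.
Qed.

Lemma size_poch (S : comNzRingType) (p : {poly S}) n :
  (size p <= 2)%N -> (size (poch p n) <= n.+1)%N.
Proof.
move=> sp; elim: n => [|n IH]; first by rewrite poch0 size_poly1.
rewrite pochSr (leq_trans (size_polyMleq _ _))//.
have : (size (p + n%:R)%R <= 2)%N.
  rewrite (leq_trans (size_polyD _ _))// geq_max sp /=.
  by rewrite -polyC_natr (leq_trans (size_polyC_leq1 _)).
by move=> h; have := leq_add IH h; case: (_ + _)%N => //= k; rewrite addn2.
Qed.

Lemma poch_opp_nat (S : comNzRingType) (k j : nat) :
  poch (- k%:R : S) j = (-1) ^+ j * (k ^_ j)%:R.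
Proof.
elim: j => [|j IH]; first by rewrite poch0 ffactn0 mulr1.
rewrite pochSr IH ffactnSr natrM exprS.
have [kj|jk] := ltnP k j.
  by rewrite ffact_small// mul0r !(mulr0, mul0r).
by rewrite natrB//; ring.
Qed.

Lemma poch_opp_nat_bin (S : numFieldType) (k j : nat) :
  poch (- k%:R : S) j / j`!%:R = (-1) ^+ j * 'C(k, j)%:R.
Proof.
by rewrite poch_opp_nat -bin_ffact natrM -mulrA mulfK// pnatr_eq0 -lt0n fact_gt0.
Qed.

(** The terminating identity 2F1(-n, b; c; 1) = (c - b)_n / (c)_n, multiplied
    by (c)_n so that it holds in any commutative ring. *)
Lemma chu_vandermonde (S : comNzRingType) (b c : S) n :
  \sum_(i < n.+1)
     (-1) ^+ i * 'C(n, i)%:R * (poch b i * poch (c + i%:R) (n - i)) =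
  poch (c - b) n.
Proof.
elim: n b c => [|n IH] b c.
  by rewrite big_ord1 /= !poch0 bin0 !mulr1.
(* By Pascal's rule the sum for n.+1 splits into the sum of the A i and a sum
   that is - b times the identity for n at b + 1 and c + 1. *)
pose A (i : nat) :=
  (-1) ^+ i * 'C(n, i)%:R * (poch b i * poch (c + i%:R) (n.+1 - i)).
have sumA : \sum_(i < n.+2) A i = (c + n%:R) * poch (c - b) n.
  rewrite big_ord_recr /= {2}/A bin_small// mulr0 mul0r addr0 -IH mulr_sumr.
  apply: eq_bigr => i _; have le_in : (i <= n)%N by rewrite -ltnS.
  rewrite /A subSn// pochSr natrB//; ring.
rewrite pochSr (_ : _ * (c - b + n%:R) =
  (c + n%:R) * poch (c - b) n - b * poch (c + 1 - (b + 1)) n); last first.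
  by rewrite (_ : c + 1 - (b + 1) = c - b); ring.
rewrite -sumA -IH mulr_sumr -sumrN ![\sum_(i < n.+2) _]big_ord_recl -!addrA.
congr (_ + _).
  by rewrite /A /= !bin0.
rewrite -big_split /=; apply: eq_bigr => i _.
rewrite /A /bump /= !add1n binS natrD subSS exprS pochSl.
rewrite (_ : c + 1 + i%:R = c + i.+1%:R) -?natr1; ring.
Qed.

(** * Newton expansion and alternating sums *)

Lemma eq_poly_on_seq (S : idomainType) (u : nat -> S) (p q : {poly S}) N :
  injective u -> (size p <= N.+1)%N -> (size q <= N.+1)%N ->
  (forall j, (j <= N)%N -> p.[u j] = q.[u j]) -> p = q.
Proof.
move=> u_inj sp sq pq; apply/eqP; rewrite -subr_eq0; apply/eqP.
apply: (@roots_geq_poly_eq0 _ _ [seq u i | i <- iota 0 N.+1]).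
- apply/allP => _ /mapP[i iN ->]; move: iN; rewrite mem_iota /= add0n ltnS => iN.
  by rewrite rootE hornerD hornerN pq// subrr.
- by rewrite map_inj_uniq ?iota_uniq.
- rewrite size_map size_iota (leq_trans (size_polyD _ _))//.
  by rewrite geq_max size_polyN sp.
Qed.

Lemma expr_1sub (S : comNzRingType) (p : {poly S}) N k : (k <= N)%N ->
  (1 - p) ^+ k = \sum_(i < N.+1) ((-1) ^+ i * 'C(k, i)%:R) *: p ^+ i.
Proof.
move=> kN; rewrite exprBn.
rewrite (big_ord_widen N.+1
  (fun i : nat => (-1) ^+ i * 1 ^+ (k - i) * p ^+ i *+ 'C(k, i)))//.
rewrite [LHS]big_mkcond; apply: eq_bigr => i _.
rewrite expr1n mulr1 ltnS; case: leqP => [_|ki]; last first.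
  by rewrite bin_small// mulr0 scale0r.
by rewrite -mul_polyC polyCM polyC_exp polyCN polyC1 polyC_natr -mulr_natr mulrAC.
Qed.

Section AltSum.
Variable R : realType.
Implicit Types (P : {poly R}).

Lemma alt_sumE P N k : (k <= N)%N ->
  alt_sum P k = \sum_(j < N.+1) (-1) ^+ j * 'C(k, j)%:R * P.[j%:R].
Proof.
move=> kN; under eq_bigr => j _ do rewrite -poch_opp_nat_bin.
rewrite /alt_sum (big_ord_widen N.+1
  (fun j : nat => poch (- k%:R) j / j`!%:R * P.[j%:R]))// big_mkcond.
apply: eq_bigr => j _; rewrite ltnS; case: leqP => // kj.
by rewrite poch_opp_nat_bin bin_small// mulr0 mul0r.
Qed.

(** Umbral form: [alt_sum P k] is the image of (1 - X)^k under the linear map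
    that sends X^i to P(i). *)
Lemma alt_sum_umbral P N k : (k <= N)%N ->
  alt_sum P k = \sum_(i < N.+1) ((1 - 'X) ^+ k)`_i * P.[i%:R].
Proof.
move=> kN; rewrite (alt_sumE _ _ _ kN); apply: eq_bigr => i _.
rewrite (@expr_1sub _ _ N)//.
by rewrite -(poly_def N.+1 (fun i => (-1) ^+ i * 'C(k, i)%:R)) coef_poly ltn_ord.
Qed.

(** Binomial inversion, obtained by applying the umbral map of P to
    X^j = (1 - (1 - X))^j. *)
Lemma alt_sum_inv P N j : (j <= N)%N ->
  \sum_(l < N.+1) (-1) ^+ l * 'C(j, l)%:R * alt_sum P l = P.[j%:R].
Proof.
move=> jN.
transitivity (\sum_(i < N.+1)
   (\sum_(l < N.+1) ((-1) ^+ l * 'C(j, l)%:R) *: (1 - 'X) ^+ l)`_i * P.[i%:R]).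
  under eq_bigr => l _ do
    rewrite (@alt_sum_umbral _ N l) -1?ltnS// mulr_sumr.
  rewrite exchange_big; apply: eq_bigr => i _.
  rewrite coef_sum mulr_suml; apply: eq_bigr => l _.
  by rewrite coefZ mulrA.
rewrite -(@expr_1sub _ _ N)// subKr.
rewrite (bigD1 (Ordinal (jN : (j < N.+1)%N)))//= coefXn eqxx mul1r.
rewrite big1 ?addr0// => i.
by rewrite -val_eqE coefXn /= => /negbTE ->; rewrite mul0r.
Qed.

(** Both sides have degree at most N and agree at 0, ..., N. *)
Lemma newton_expansion P N : (size P <= N.+1)%N ->
  P = \sum_(l < N.+1) (alt_sum P l / l`!%:R) *: poch (- 'X) l.
Proof.
move=> sP; apply: (@eq_poly_on_seq _ (fun j : nat => j%:R : R) _ _ N) => //.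
    by move=> i j /eqP; rewrite eqr_nat => /eqP.
  apply: (leq_trans (size_sum _ _ _)); apply/bigmax_leqP => l _.
  rewrite (leq_trans (size_scale_leq _ _))// (leq_trans (size_poch _ _ _ _))//.
  by rewrite size_polyN size_polyX.
move=> j jN; rewrite -(@alt_sum_inv P N j)// horner_sum.
apply: eq_bigr => l _; rewrite hornerZ horner_poch hornerN hornerX.
by rewrite -poch_opp_nat_bin mulrC mulrA mulrAC.
Qed.

Lemma poch_opp_nat_small (i l : nat) : (i < l)%N -> poch (- i%:R : R) l = 0.
Proof. by move=> il; rewrite poch_opp_nat ffact_small// mulr0. Qed.

(** * The Miller-Paris operator *)

Lemma bin_mul_ffact (l n i : nat) : (i <= n)%N ->
  ('C(l + n, l + i) * (l + i) ^_ l = (l + n) ^_ l * 'C(n, i))%N.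
Proof.
move=> le_in; apply/eqP.
rewrite -(@eqn_pmul2r (i`! * (n - i)`!)%N) ?muln_gt0 ?fact_gt0//; apply/eqP.
have e1 := bin_fact (leq_add (leqnn l) le_in).
have e2 := ffact_fact (leq_addr i l); have e3 := ffact_fact (leq_addr n l).
have e4 := bin_fact le_in.
rewrite subnDl in e1; rewrite !addKn in e2 e3.
by rewrite -[RHS]mulnA e4 e3 -e1 -e2 -!mulnA.
Qed.

(** The factor (-j)_l kills the terms with j < l; after the shift j = l + i the
    sum is the Chu-Vandermonde sum of order k - l at e + l and c + l. *)
Lemma alt_sum_poch_ratio (c e : R) l k : (l <= k)%N -> poch c k != 0 ->
  \sum_(j < k.+1)
    (-1) ^+ j * 'C(k, j)%:R * (poch e j / poch c j * poch (- j%:R) l) =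
  (-1) ^+ l * poch (- k%:R) l * poch e l * poch (c - e) (k - l) / poch c k.
Proof.
move=> /subnKC <-; move: (k - l)%N => n; rewrite addKn => ck0.
rewrite -addnS big_split_ord /= big1 ?add0r => [|j _]; last first.
  by rewrite poch_opp_nat_small// !mulr0.
rewrite (_ : c - e = c + l%:R - (e + l%:R)); last by ring.
rewrite -chu_vandermonde mulr_sumr mulr_suml; apply: eq_bigr => i _.
have le_in : (i <= n)%N by rewrite -ltnS.
have cE : poch c (l + n) = poch c (l + i) * poch (c + l%:R + i%:R) (n - i).
  by rewrite -addrA -natrD -pochD -addnA subnKC.
rewrite !poch_opp_nat.
have /(congr1 (fun u : nat => u%:R : R)) := bin_mul_ffact l _ _ le_in.
rewrite !natrM => binE.
rewrite cE mulf_eq0 negb_or in ck0; case/andP: ck0 => c1 c2.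
rewrite cE (pochD _ e) exprD.
transitivity ((-1) ^+ l * (-1) ^+ i * (-1) ^+ l *
   ('C(l + n, l + i)%:R * ((l + i) ^_ l)%:R)
   * poch e l * poch (e + l%:R) i / poch c (l + i)).
  by ring.
by rewrite binE; field; rewrite c1 c2.
Qed.

(** The alternating sums of F(j) = (c + p)_j / (c)_j H(j) are the values of the
    first Miller-Paris operator T(c + p; c) on H, up to a ratio of Pochhammer
    symbols. The hypothesis 0 < p makes its normalising factor (- om - p)_om
    nonzero. *)
Lemma alt_sum_miller_paris (F H : {poly R}) (c : R) (om p k : nat) :
  (size H <= om.+1)%N -> (0 < p)%N -> (k <= om + p)%N -> poch c k != 0 ->
  (forall j : nat, (j <= k)%N ->
     F.[j%:R] = poch (c + p%:R) j / poch c j * H.[j%:R]) ->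
  alt_sum F k = poch (- (om + p)%:R) k / poch c k
                * (miller_paris1 om (c + p%:R) c H).[k%:R].
Proof.
move=> sH p_gt0 kM ck0 FH; set e := c + p%:R; set M := (om + p)%N.
have cE : c - e - om%:R = - M%:R by rewrite /e /M natrD; ring.
have M0 : poch (- M%:R : R) om != 0.
  apply: poch_neq0 => i iom; rewrite eqr_opp eqr_nat gtn_eqF//.
  by rewrite (ltn_trans iom)// /M -[X in (X < _)%N]addn0 ltn_add2l.
rewrite (alt_sumE _ _ _ (leqnn k)) /miller_paris1 cE hornerZ horner_sum !mulr_sumr.
(* Expand H by Newton's formula and exchange the two sums. *)
transitivity (\sum_(l < om.+1) alt_sum H l / l`!%:R * \sum_(j < k.+1)
    (-1) ^+ j * 'C(k, j)%:R * (poch e j / poch c j * poch (- j%:R) l)).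
  under [RHS]eq_bigr => l _ do rewrite mulr_sumr.
  rewrite exchange_big; apply: eq_bigr => j _ /=.
  rewrite FH -1?ltnS// {1}(newton_expansion _ _ sH) horner_sum !mulr_sumr.
  apply: eq_bigr => l _; rewrite hornerZ horner_poch hornerN hornerX.
  by ring.
apply: eq_bigr => l _.
rewrite hornerZ hornerM !horner_poch hornerN hornerD hornerX hornerC.
have [lk|kl] := leqP l k; last first.
  rewrite big1 ?(mulr0, poch_opp_nat_small _ _ kl, mul0r)// => j _.
  rewrite poch_opp_nat_small ?mulr0//.
  by rewrite (leq_ltn_trans _ kl)// -ltnS.
have lom : (l <= om)%N by rewrite -ltnS.
rewrite alt_sum_poch_ratio//.
(* Both products are (- M)_(om + k - l), cut at k or at om. *)
have swap : poch (- M%:R : R) k * poch (- M%:R + k%:R) (om - l) =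
    poch (- M%:R) om * poch (c - e) (k - l).
  rewrite (_ : c - e = - M%:R + om%:R); last by rewrite -cE; ring.
  by rewrite -!pochD; congr (poch _ _); rewrite !addnBA// addnC.
transitivity ((poch (- M%:R) om)^-1 * (poch (- M%:R) om * poch (c - e) (k - l))
   * (alt_sum H l / l`!%:R * (-1) ^+ l * poch (- k%:R) l * poch e l / poch c k)).
  by rewrite mulKf//; ring.
by rewrite -swap; ring.
Qed.

End AltSum.

(** * The binomial series *)

Section Binomial.
Variable R : realType.
Implicit Types (b x : R).
Local Open Scope classical_set_scope.

(** The coefficient (b)_n / n! of x^n in the expansion of (1 - x)^(-b). *)
Definition binom_coef b (n : nat) : R := poch b n / n`!%:R.

Let fact0 n : n`!%:R != 0 :> R.
Proof. by rewrite pnatr_eq0 -lt0n fact_gt0. Qed.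

Lemma binom_coef0 b : binom_coef b 0 = 1.
Proof. by rewrite /binom_coef poch0 divr1. Qed.

(** The identity (1 - x) (1 - x)^(- b - 1) = (1 - x)^(-b) at the level of
    partial sums. *)
Lemma pseries_binom_telescope b x N :
  pseries (binom_coef b) x N.+1 =
  pseries (binom_coef (b + 1)) x N.+1 - x * pseries (binom_coef (b + 1)) x N.
Proof.
rewrite /pseries /series /= mulr_sumr !big_nat_recl//.
rewrite !binom_coef0 -addrA -sumrB; congr (_ + _).
apply: eq_bigr => n _; rewrite /binom_coef pochSl pochSr factS natrM exprS.
by field; rewrite fact0 nat1r pnatr_eq0.
Qed.

Lemma pseries_diffs_binom b :
  pseries_diffs (binom_coef b) = b *: binom_coef (b + 1).
Proof.
apply/funext => n; rewrite /pseries_diffs /binom_coef pochSl factS natrM /=.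
rewrite [RHS](_ : _ = b * (poch (b + 1) n / n`!%:R))//.
by field; rewrite fact0 nat1r pnatr_eq0.
Qed.

Lemma binom_coef_nat_ge0 (B n : nat) : 0 <= binom_coef B%:R n.
Proof.
rewrite /binom_coef divr_ge0// ?ler0n//; apply: prodr_ge0 => i _.
by rewrite -natrD ler0n.
Qed.

(** For a natural exponent B and 0 <= x < 1 the partial sums are bounded by
    (1 - x)^(-B), by induction on B with [pseries_binom_telescope]. *)
Lemma pseries_binom_nat_le (B : nat) x N : 0 <= x -> x < 1 ->
  pseries (binom_coef B%:R) x N <= ((1 - x)^-1) ^+ B.
Proof.
move=> x0 x1; have x1' : 0 < 1 - x by rewrite subr_gt0.
elim: B N => [|B IH] [|N].
- by rewrite /pseries /series /= big_nil.
- rewrite /pseries /series /= big_nat_recl//= big1 => [|i _].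
    by rewrite binom_coef0 expr0 mulr1 addr0.
  by rewrite /binom_coef pochSl !mul0r.
- by rewrite /pseries /series /= big_nil exprn_ge0// invr_ge0 ltW.
- rewrite exprS ler_pdivlMl// (le_trans _ (IH N.+1))//.
  rewrite (pseries_binom_telescope B%:R) natr1 mulrBl mul1r lerB// ler_wpM2l//.
  rewrite /pseries /series /= big_nat_recr//= lerDl.
  by rewrite mulr_ge0 ?binom_coef_nat_ge0// exprn_ge0.
Qed.

(** Absolute convergence by comparison: |(b)_n| <= (B)_n for a natural B >= |b|. *)
Lemma is_cvg_pseries_binom b x : `|x| < 1 -> cvgn (pseries (binom_coef b) x).
Proof.
move=> x1; apply: normed_cvg.
set B := Num.bound `|b|.
have bB : `|b| <= B%:R by rewrite ltW// archi_boundP.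
apply: (@series_le_cvg _ _ (fun n => binom_coef B%:R n * `|x| ^+ n)) => [n|n|n|].
- by rewrite /= normr_ge0.
- by rewrite mulr_ge0 ?binom_coef_nat_ge0// exprn_ge0.
- rewrite /= normrM normrX ler_wpM2r ?exprn_ge0//.
  rewrite /binom_coef normrM normfV [`|_`!%:R|]ger0_norm ?ler0n//.
  rewrite ler_wpM2r ?invr_ge0 ?ler0n// /poch normr_prod ler_prod// => i _.
  rewrite normr_ge0/= (le_trans (ler_normD _ _))// lerD//.
  by rewrite ger0_norm ?ler0n.
- apply: nondecreasing_is_cvgn.
    apply/nondecreasing_seqP => N; rewrite /series /= big_nat_recr//= lerDl.
    by rewrite mulr_ge0 ?binom_coef_nat_ge0// exprn_ge0.
  exists ((1 - `|x|)^-1 ^+ B) => _ [N _ <-].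
  exact: pseries_binom_nat_le.
Qed.

(** The sum of the binomial series; meaningful for |x| < 1. *)
Definition binom_series b x : R := limn (pseries (binom_coef b) x).

Lemma binom_series_step b x : `|x| < 1 ->
  binom_series b x = (1 - x) * binom_series (b + 1) x.
Proof.
move=> x1; apply/cvg_lim => //; rewrite -cvg_shiftS.
rewrite (_ : [sequence _]_n = (fun N =>
  pseries (binom_coef (b + 1)) x N.+1 -
  x * pseries (binom_coef (b + 1)) x N)); last first.
  by apply/funext => N; rewrite /= pseries_binom_telescope.
have cv := is_cvg_pseries_binom (b + 1) _ x1.
rewrite mulrBl mul1r; apply: cvgB.
  by rewrite (cvg_shiftS (pseries (binom_coef (b + 1)) x)); exact: cv.
by apply: cvgMr; exact: cv.
Qed.

Lemma pseriesZ (k : R) (c : R^nat) x : pseries (k *: c) x = k *: pseries c x.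
Proof.
apply/funext => N; rewrite -[RHS]/(k * pseries c x N) /pseries /series /= mulr_sumr.
by apply: eq_bigr => i _; rewrite -[(k *: c) i]/(k * c i) -mulrA.
Qed.

(** Termwise differentiation at x, inside a disc of radius K with |x| < K < 1. *)
Lemma is_derive_binom_series b x : `|x| < 1 ->
  is_derive x (1 : R) (binom_series b) (b * binom_series (b + 1) x).
Proof.
move=> x1; pose K := (`|x| + 1) / 2.
have xK : `|x| < K by rewrite /K; lra.
have K0 : 0 <= K by rewrite (le_trans _ (ltW xK)).
have K1 : `|K| < 1 by rewrite ger0_norm// /K; lra.
have cvK c := is_cvg_pseries_binom c _ K1.
have d : b * binom_series (b + 1) x =
    limn (pseries (pseries_diffs (binom_coef b)) x).
  rewrite pseries_diffs_binom pseriesZ; apply/esym/cvg_lim => //.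
  by apply: cvgMr; apply: is_cvg_pseries_binom.
rewrite d; apply: (@pseries_snd_diffs _ _ K).
- exact: cvK.
- by rewrite pseries_diffs_binom pseriesZ; apply: is_cvgMr; exact: cvK.
- rewrite (_ : pseries_diffs (pseries_diffs _) =
    (b * (b + 1)) *: binom_coef (b + 1 + 1)).
    by rewrite pseriesZ; apply: is_cvgMr; exact: cvK.
  rewrite -scalerA -pseries_diffs_binom pseries_diffs_binom.
  apply/funext => n; rewrite /pseries_diffs.
  by rewrite -[LHS]/(_ * (b * _)) -[RHS]/(b * (_ * _)) mulrCA.
- by rewrite [X in _ < X]ger0_norm.
Qed.

Lemma is_derive_0_ball_cst (f : R -> R) (r x : R) :
  (forall y, `|y| < r -> is_derive y (1 : R) f 0) -> `|x| < r -> f x = f 0.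
Proof.
move=> df xr.
have seg u v : u <= v -> `|u| < r -> `|v| < r -> f v = f u.
  move=> uv ur vr.
  have inr y : u <= y -> y <= v -> `|y| < r.
    move: ur vr; rewrite !ltr_norml => /andP[u1 u2] /andP[v1 v2] y1 y2.
    by apply/andP; split; lra.
  have [y yuv|y|c _] := @MVT_segment R f (fun=> 0) u v uv.
  - by apply: df; move: yuv; rewrite in_itv /= => /andP[/ltW ? /ltW ?]; exact: inr.
  - apply: derivable_within_continuous => z; rewrite in_itv /= => /andP[z1 z2].
    by have [] := df z (inr z z1 z2).
  - by rewrite mul0r => /eqP; rewrite subr_eq0 => /eqP.
have r0 : `|0 : R| < r by rewrite normr0 (le_lt_trans _ xr).
by have [x0|/ltW x0] := leP 0 x; [exact: seg|apply/esym; exact: seg].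
Qed.

(** The product of the series and (1 - x)^b has derivative 0 on the disc and
    value 1 at 0. *)
Lemma binom_seriesE b x : `|x| < 1 -> binom_series b x = (1 - x) `^ (- b).
Proof.
move=> x1.
have pos (y : R) : `|y| < 1 -> 0 < 1 - y.
  by rewrite ltr_norml subr_gt0 => /andP[].
have h : binom_series b x * (1 - x) `^ b = 1.
  transitivity (binom_series b 0 * (1 - 0) `^ b); last first.
    rewrite subr0 powR1 mulr1; apply/cvg_lim => //; rewrite -cvg_shiftS.
    rewrite (_ : [sequence _]_n = (fun=> 1)); first exact: cvg_cst.
    apply/funext => N; rewrite /= /pseries /series /= big_nat_recl// big1.
      by rewrite binom_coef0 expr0 mulr1 addr0.
    by move=> i _; rewrite expr0n mulr0.
  apply: (@is_derive_0_ball_cst (fun y => binom_series b y * (1 - y) `^ b) 1 x)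
    => //.
  move=> y y1; have dB := is_derive_binom_series b _ y1.
  have y0 := pos _ y1.
  have dP : is_derive y 1 (fun z => (1 - z) `^ b) (- (b * (1 - y) `^ (b - 1))).
    have d1 : is_derive y 1 (fun z : R => 1 - z) (- 1).
      by apply: is_derive_eq; rewrite add0r mul1r.
    have := @is_derive1_comp R (fun z : R => z `^ b) (fun z : R => 1 - z) y _ _
      (is_derive1_powR b y0) d1.
    by rewrite mulrN1.
  have powS : (1 - y) `^ b = (1 - y) * (1 - y) `^ (b - 1).
    rewrite -{2}[1 - y]powRr1 ?(ltW y0)// -powRD ?(gt_eqF y0) ?implybT//.
    by congr (_ `^ _); ring.
  apply: is_derive_eq.
  rewrite /GRing.scale /= (binom_series_step b _ y1) powS; ring.
rewrite powRN -[LHS]mulr1 -[X in _ * X](@divff _ ((1 - x) `^ b)).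
  by rewrite mulrA h mul1r.
by rewrite gt_eqF// powR_gt0// pos.
Qed.

End Binomial.

Arguments binom_coef {R} b n.
Arguments binom_series {R} b x.

(** * Exchange of the monomial and Bernstein bases *)

Section Flip.
Variable K : realType.
Implicit Types (p q : {poly K}) (x y : K).

(** The polynomial (1 - x)^m p(x / (x - 1)) for p of degree at most m, given by
    its Bernstein coefficients so that it is a polynomial by construction; see
    [horner_bern_flip]. *)
Definition bern_flip (m : nat) p : {poly K} :=
  \sum_(k < m.+1) ((-1) ^+ k * p`_k) *: bern m k.

Lemma size_bern m k : (k <= m)%N -> (size (bern m k : {poly K}) <= m.+1)%N.
Proof.
move=> km; have s1X : (size (1 - 'X : {poly K})%R <= 2)%N.
  by rewrite (leq_trans (size_polyD _ _))// size_polyN size_polyX size_poly1.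
rewrite /bern (leq_trans (size_polyMleq _ _))// size_polyXn /=.
apply: (leq_trans (leq_add (leqnn k) (size_poly_exp_leq _ _))).
rewrite addnS ltnS -[leqRHS](subnKC km) leq_add2l.
rewrite -[leqRHS]mul1n leq_mul2r.
by case: (size _) s1X => [|[|[]]]//=; rewrite ?orbT.
Qed.

Lemma size_bern_flip m p : (size (bern_flip m p) <= m.+1)%N.
Proof.
apply: (leq_trans (size_sum _ _ _)); apply/bigmax_leqP => k _.
by rewrite (leq_trans (size_scale_leq _ _))// size_bern// -ltnS.
Qed.

Lemma horner_bern_flip m p x : (size p <= m.+1)%N -> x != 1 ->
  (bern_flip m p).[x] = (1 - x) ^+ m * p.[x / (x - 1)].
Proof.
move=> sp x1; have x10 : x - 1 != 0 by rewrite subr_eq0.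
rewrite (horner_coef_wide _ sp) mulr_sumr /bern_flip horner_sum.
apply: eq_bigr => k _; have km : (k <= m)%N by rewrite -ltnS.
rewrite hornerZ /bern hornerM hornerXn horner_exp hornerD hornerN hornerX hornerC.
have kE : (1 - x) ^+ k * (x / (x - 1)) ^+ k = (-1) ^+ k * x ^+ k.
  by rewrite -exprMn -exprNn; congr (_ ^+ _); field.
have mE : (1 - x) ^+ m = (1 - x) ^+ (m - k) * (1 - x) ^+ k.
  by rewrite -exprD subnK.
rewrite mE -mulrA mulrCA -mulrA [X in _ = _ * X]mulrCA kE; ring.
Qed.

Lemma bern_flipK m p : (size p <= m.+1)%N -> bern_flip m (bern_flip m p) = p.
Proof.
move=> sp; apply: (@eq_poly_on_seq _ (fun i : nat => i.+2%:R : K) _ _ m) => //.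
- by move=> i j /eqP; rewrite eqr_nat => /eqP[].
- exact: size_bern_flip.
move=> j _; set x : K := j.+2%:R.
have x1 : x - 1 != 0 by rewrite subr_eq0 pnatr_eq1.
have y1 : x / (x - 1) != 1.
  by rewrite -subr_eq0 (_ : _ - 1 = (x - 1)^-1) ?invr_neq0//; field.
rewrite !horner_bern_flip ?size_bern_flip// -1?subr_eq0//.
rewrite mulrA -exprMn (_ : (1 - x) * _ = 1); last by field.
rewrite expr1n mul1r; congr (_.[_]); clearbody x; field.
by rewrite x1 (_ : x + -1 * (x - 1) = 1) ?oner_neq0//; ring.
Qed.

(** Uniqueness of Bernstein coefficients: a Bernstein combination is the image
    under [bern_flip] of a polynomial q, and [bern_flip] is injective. *)
Lemma bern_combE m p (b : 'I_m.+1 -> K) : (size p <= m.+1)%N ->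
  bern_flip m p = \sum_(k < m.+1) b k *: bern m k <->
  (forall k : 'I_m.+1, b k = (-1) ^+ k * p`_k).
Proof.
move=> sp; split => [pb|bE]; last by apply: eq_bigr => k _; rewrite bE.
pose q := \poly_(k < m.+1) ((-1) ^+ k * b (inord k)).
have sq : (size q <= m.+1)%N by exact: size_poly.
have bq (k : 'I_m.+1) : b k = (-1) ^+ k * q`_k.
  by rewrite coef_poly ltn_ord inord_val mulrA -expr2 sqrr_sign mul1r.
have pq : bern_flip m p = bern_flip m q.
  by rewrite pb; apply: eq_bigr => k _; rewrite bq.
by move=> k; rewrite bq -(bern_flipK m p sp) pq bern_flipK.
Qed.

End Flip.

Arguments bern_flip {K} m p.

(** * The generating series *)

Section Series.
Variable R : realType.
Implicit Types (a x : R) (F : {poly R}).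
Local Open Scope classical_set_scope.

Lemma bin_binom_coef a n l :
  'C(n + l, l)%:R * binom_coef a (n + l) = binom_coef a l * binom_coef (a + l%:R) n.
Proof.
have f0 k : k`!%:R != 0 :> R by rewrite pnatr_eq0 -lt0n fact_gt0.
have /(congr1 (fun u : nat => u%:R : R)) := bin_fact (leq_addl n l).
rewrite addnK !natrM => e.
rewrite /binom_coef [in poch a (n + l)%N]addnC pochD -e.
have C0 : 'C(n + l, l)%:R != 0 :> R by rewrite pnatr_eq0 -lt0n bin_gt0 leq_addl.
by field; rewrite !f0 C0.
Qed.

Lemma cvg_bin_series a x l : `|x| < 1 ->
  [series 'C(n, l)%:R * binom_coef a n * x ^+ n]_n @ \oo -->
  binom_coef a l * x ^+ l * (1 - x) `^ (- (a + l%:R)).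
Proof.
move=> x1; set u : R^nat := (fun n => _); rewrite -(cvg_shiftn l).
rewrite (_ : [sequence (series u) (n + l)%N]_n = (fun N => binom_coef a l * x ^+ l
    * pseries (binom_coef (a + l%:R)) x N)); last first.
  apply/funext => N; rewrite /= /pseries /series /= /u
    (big_cat_nat (n := l)) ?leq_addl//=.
  rewrite big_nat_cond big1 ?add0r => [|i /andP[/andP[_ il] _]]; last first.
    by rewrite bin_small// !mul0r.
  rewrite -{1}[l]add0n big_addn addnK mulr_sumr; apply: eq_bigr => i _.
  by rewrite bin_binom_coef exprD; ring.
apply: cvgMr; rewrite -binom_seriesE//; exact: is_cvg_pseries_binom.
Qed.

(** Newton's expansion of F(n) turns the series into a finite combination of the
    series of [cvg_bin_series]. *)
Lemma hyp_series_cvg a F m x : (size F <= m.+1)%N -> `|x| < 1 ->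
  hyp_series a F x @ \oo --> (1 - x) `^ (- a) * (w_poly a m F).[x / (x - 1)].
Proof.
move=> sF x1; have x0 : 0 < 1 - x by move: x1; rewrite ltr_norml subr_gt0 => /andP[].
rewrite (_ : hyp_series a F x = (fun N => \sum_(l < m.+1)
   ((-1) ^+ l * alt_sum F l) *
   [series 'C(n, l)%:R * binom_coef a n * x ^+ n]_n N)); last first.
  apply/funext => N; rewrite /hyp_series /series /=.
  under [RHS]eq_bigr => l _ do rewrite mulr_sumr.
  rewrite exchange_big; apply: eq_bigr => n _ /=.
  rewrite {1}(newton_expansion _ _ _ sF) horner_sum !mulr_suml.
  apply: eq_bigr => l _; rewrite hornerZ horner_poch hornerN hornerX.
  rewrite -[_ * poch _ l]mulrA [_^-1 * _]mulrC poch_opp_nat_bin.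
  by rewrite /binom_coef; ring.
rewrite (_ : _ * _ = \sum_(l < m.+1) ((-1) ^+ l * alt_sum F l) *
  (binom_coef a l * x ^+ l * (1 - x) `^ (- (a + l%:R)))).
  apply: cvg_big => [|l _]; first exact: add_continuous.
  by apply: cvgMr; exact: cvg_bin_series.
rewrite (@horner_coef_wide _ m.+1) ?size_poly// mulr_sumr; apply: eq_bigr => l _.
rewrite coef_poly ltn_ord opprD powRD ?(gt_eqF x0) ?implybT//.
rewrite powR_invn ?ltW// (_ : x / (x - 1) = - (x / (1 - x))); last first.
  by field; rewrite !subr_eq0 [1 == x]eq_sym lt_eqF// -subr_gt0.
by rewrite (exprNn (x / (1 - x))) expr_div_n /binom_coef; ring.
Qed.

Lemma is_what_bern_flip a F m : (size F <= m.+1)%N ->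
  is_what a m F (bern_flip m (w_poly a m F)).
Proof.
move=> sF; split => [|x x1]; first exact: size_bern_flip.
have x0 : 0 < 1 - x by move: x1; rewrite ltr_norml subr_gt0 => /andP[].
rewrite horner_bern_flip ?size_poly//; last first.
  by move: x0; rewrite subr_gt0 => /lt_eqF ->.
rewrite powRD ?(gt_eqF x0) ?implybT// powR_mulrn ?ltW//.
rewrite invfM mulrACA divff ?expf_neq0 ?gt_eqF//.
by rewrite mul1r mulrC -powRN; exact: hyp_series_cvg.
Qed.

Lemma is_w_w_poly a F m : (size F <= m.+1)%N -> is_w a m F (w_poly a m F).
Proof.
move=> sF; split => [|x x1]; first exact: size_poly.
have x0 : 0 < 1 - x by move: x1; rewrite ltr_norml subr_gt0 => /andP[].
have -> : (w_poly a m F).[x / (x - 1)] =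
    (1 - x) `^ a * ((1 - x) `^ (- a) * (w_poly a m F).[x / (x - 1)]).
  by rewrite powRN mulVKf// gt_eqF// powR_gt0.
by apply: cvgMr; exact: hyp_series_cvg.
Qed.

Let norm_inv_lt1 (i : nat) : `|(i.+2%:R : R)^-1| < 1.
Proof. by rewrite ger0_norm ?invr_ge0 ?ler0n// invf_lt1 ?ltr0n// ltr1n. Qed.

(** The points 1 / (i + 2) are infinitely many and lie in the open unit disc. *)
Lemma is_what_unique a F m p q : is_what a m F p -> is_what a m F q -> p = q.
Proof.
move=> [sp cp] [sq cq].
apply: (@eq_poly_on_seq _ (fun i : nat => (i.+2%:R : R)^-1) _ _ m) => //.
  by move=> i j /invr_inj /eqP; rewrite eqr_nat => /eqP[].
move=> j _; set x := _^-1; have x1 : `|x| < 1 by exact: norm_inv_lt1.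
have x0 : 0 < 1 - x by move: x1; rewrite ltr_norml subr_gt0 => /andP[].
have e := cvg_unique (@norm_hausdorff _ _) (cp x x1) (cq x x1).
have c0 : ((1 - x) `^ (m%:R + a))^-1 != 0 by rewrite invr_neq0// gt_eqF// powR_gt0.
exact: (mulIf c0 (e _)).
Qed.

(** At x = 1 / (i + 2) the argument x / (x - 1) is - 1 / (i + 1). *)
Lemma is_w_unique a F m p q : is_w a m F p -> is_w a m F q -> p = q.
Proof.
move=> [sp cp] [sq cq].
have x1 (j : nat) := norm_inv_lt1 j.
pose y (j : nat) : R := j.+2%:R^-1 / (j.+2%:R^-1 - 1).
apply: (@eq_poly_on_seq _ y _ _ m) => // [i j|j _]; last first.
  exact: (cvg_unique (@norm_hausdorff _ _) (cp _ (x1 j)) (cq _ (x1 j))).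
have yE k : y k = - (k.+1%:R)^-1.
  have k0 : k.+1%:R != 0 :> R by rewrite pnatr_eq0.
  have k1 : k.+1%:R + 1 != 0 :> R by rewrite natr1 pnatr_eq0.
  rewrite /y -(natr1 k.+1); move: (k.+1%:R : R) k0 k1 => c c0 c1.
  field; rewrite c0 c1 (_ : 1 + -1 * (c + 1) = - c) ?oppr_eq0 ?c0//; ring.
by rewrite !yE => /oppr_inj /invr_inj /eqP; rewrite eqr_nat => /eqP[].
Qed.

End Series.

(** * Quotients of Pochhammer symbols *)

Section PochQuotient.
Variables (R : realType) (r : nat) (f : 'I_r.+1 -> R) (mm : 'I_r.+1 -> nat).

Lemma size_poch_quotient (P : pred 'I_r.+1) :
  (size (poch_quotient P f mm) <= (\sum_(i < r.+1 | P i) mm i).+1)%N.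
Proof.
rewrite (leq_trans (size_scale_leq _ _))//.
elim/big_rec2: _ => [|i p n _ IH]; first by rewrite size_poly1.
rewrite (leq_trans (size_polyMleq _ _))//.
have : (size (poch ((f i)%:P + 'X) (mm i)) <= (mm i).+1)%N.
  by rewrite size_poch// addrC size_XaddC.
move=> h; have := leq_add h IH; case: (_ + _)%N => //= k.
by rewrite addSn addnS ltnS.
Qed.

(** Uses (c + j)_p / (c)_p = (c + p)_j / (c)_j for c = f_1 and p = m_1. *)
Lemma horner_poch_quotient_ord0 (j : nat) :
  (forall n : nat, f ord0 != - n%:R) ->
  (poch_quotient xpredT f mm).[j%:R] =
  poch (f ord0 + (mm ord0)%:R) j / poch (f ord0) j
  * (poch_quotient (fun i => i != ord0) f mm).[j%:R].
Proof.
move=> hf; rewrite /poch_quotient !hornerZ !(bigD1 ord0 (P := xpredT))//= hornerM invfM.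
rewrite horner_poch hornerD hornerC hornerX.
have p0 n : poch (f ord0) n != 0 by apply: poch_neq0 => i _; exact: hf.
suff -> : poch (f ord0 + (mm ord0)%:R) j / poch (f ord0) j =
   poch (f ord0 + j%:R) (mm ord0) / poch (f ord0) (mm ord0) by ring.
by apply/eqP; rewrite eqr_div// mulrC -pochD [eqbRHS]mulrC -pochD addnC.
Qed.

End PochQuotient.

Theorem proposition2 (R : realType) (r : nat)
    (f : 'I_r.+1 -> R) (mm : 'I_r.+1 -> nat) (a : R)
    (hmm : forall i : 'I_r.+1, (0 < mm i)%N)
    (hf : forall (i : 'I_r.+1) (n : nat), f i != - n%:R) :
  let m := (\sum_(i < r.+1) mm i)%N in
  let f1 := f ord0 in
  let m1 := mm ord0 in
  let omega := (m - m1)%N in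
  let F := poch_quotient xpredT f mm in
  let H := poch_quotient (fun i : 'I_r.+1 => i != ord0) f mm in
  let Q := miller_paris1 omega (f1 + m1%:R) f1 H in
  let w := w_poly a m F in
  [/\ exists! wh : {poly R}, is_what a m F wh,
      unique (is_w a m F) w
    & forall wh : {poly R}, is_what a m F wh ->
      [/\ forall x : R, x != 1 -> wh.[x] = (1 - x) ^+ m * w.[x / (x - 1)],
          wh = \sum_(k < m.+1)
                 ((-1) ^+ k * (poch a k * poch (- m%:R) k
                               / (poch f1 k * k`!%:R)) * Q.[k%:R])
                 *: bern m k,
          forall b : 'I_m.+1 -> R,
            wh = \sum_(k < m.+1) b k *: bern m k <->
            (forall k : 'I_m.+1, b k = (-1) ^+ k * w`_k)
        & forall b : 'I_m.+1 -> R,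
            w = \sum_(k < m.+1) b k *: bern m k <->
            (forall k : 'I_m.+1, b k = (-1) ^+ k * wh`_k)]].
Proof.
move=> m f1 m1 omega F H Q w.
have sF : (size F <= m.+1)%N by exact: size_poch_quotient.
have m1m : (m1 <= m)%N by rewrite /m (bigD1 ord0)//= leq_addr.
have sH : (size H <= omega.+1)%N.
  rewrite (leq_trans (size_poch_quotient _ _ _ _ _))//.
  by rewrite /omega /m (bigD1 ord0 (P := xpredT))//= addKn.
have sw : (size w <= m.+1)%N by exact: size_poly.
have whatE wh : is_what a m F wh -> wh = bern_flip m w.
  by move=> /is_what_unique; apply; exact: is_what_bern_flip.
split.
- exists (bern_flip m w); split; first exact: is_what_bern_flip.
  by move=> wh /whatE ->.
- split; first exact: is_w_w_poly.
  by move=> p; apply: is_w_unique; exact: is_w_w_poly.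
move=> wh /whatE ->; split.
- by move=> x x1; rewrite horner_bern_flip.
- apply: eq_bigr => k _; congr (_ *: _); rewrite -mulrA; congr (_ * _).
  rewrite coef_poly ltn_ord (@alt_sum_miller_paris _ F H f1 omega m1).
  + by rewrite /omega subnK// invfM; ring.
  + exact: sH.
  + exact: hmm.
  + by rewrite /omega subnK// -ltnS.
  + by apply: poch_neq0 => i _; exact: hf.
  + by move=> j _; apply: horner_poch_quotient_ord0.
- by move=> b; exact: bern_combE.
(* w is the image of w-hat under the same involution. *)
- move=> b; rewrite -{1}(bern_flipK _ m w sw).
  by apply: bern_combE; exact: size_bern_flip.
Qed.
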